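(* Let $n\ge 1$, $K=\{0,1\}$, let $A=(a_{ij})_{i,j=1}^n$ be a real symmetric matrix, and let $(k^\uparrow_i)_{i=1}^n$ and $(k^\downarrow_i)_{i=1}^n$ be sequences of real numbers (up-thresholds and down-thresholds). Let $\mathbf{F}=(f_1,\dots,f_n)\colon K^n\to K^n$ be the synchronous graph dynamical system map over the complete graph of order $n$ with vertex functions $$f_i(x_1,\dots,x_n)=\begin{cases}1 & \text{if } x_i=0 \text{ and } \sum_{j=1}^n a_{ij}x_j\ge k^\uparrow_i,\\ 0 & \text{if } x_i=1 \text{ and } \sum_{j=1}^n a_{ij}x_j< k^\downarrow_i,\\ x_i & \text{otherwise.}\end{cases}$$ Then for every $x\in K^n$ there exists $s\in\mathbb{N}$ such that $\mathbf{F}^{s+2}(x)=\mathbf{F}^{s}(x)$.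
   Context: $\mathbf{F}$ synchronous means $\mathbf{F}(x)=(f_1(x),\dots,f_n(x))$, all coordinates being updated simultaneously (over the complete graph each vertex function may depend on all coordinates). $\mathbf{F}^s$ denotes the $s$-fold iterate of $\mathbf{F}$. *)

(* Defs.v *)
From mathcomp Require Import all_boot all_order all_algebra.
From mathcomp Require Import reals.

Set Implicit Arguments.
Unset Strict Implicit.
Unset Printing Implicit Defensive.

Import GRing.Theory.
Local Open Scope ring_scope.

(* Over the complete graph every vertex function may read the whole state, so
   vertex i carries an arbitrary function K^n -> K. *)
Definition synchronous_map (K : Type) (n : nat)
    (f : 'I_n -> {ffun 'I_n -> K} -> K) (x : {ffun 'I_n -> K}) :
    {ffun 'I_n -> K} :=
  [ffun i => f i x].

(* The state set {0,1} is bool, with true = 1 and false = 0. *)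
Definition bithreshold (R : realType) (n : nat) (A : 'M[R]_n)
    (kup kdown : 'I_n -> R) (i : 'I_n) (x : {ffun 'I_n -> bool}) : bool :=
  let sigma := \sum_(j < n) A i j * (x j)%:R in
  if ~~ x i && (kup i <= sigma) then true
  else if x i && (sigma < kdown i) then false
  else x i.

(* Main.v *)
Require Import Defs.
From mathcomp Require Import all_boot all_order all_algebra.
From mathcomp Require Import reals.
From mathcomp Require Import ring lra.

(** Since [kup i - (kup i - kdown i) * x i] is the threshold in force at vertex
  [i], the bithreshold map is an ordinary threshold map for the symmetric matrix
  [A + diag (kup - kdown)].  For a threshold map [F] the Goles-Olivos energy
  [E x = sum_i (theta_i (x_i + (F x)_i) - (F x)_i (B x)_i)] does not increase
  along [F], and if [E (F x) = E x] then [x <= F (F x)] coordinatewise.  Take a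
  state minimizing [E] on the orbit, and on the orbit of that state, where [E]
  is constant, a state [z] maximizing the number of ones in [z] and [F z]; then
  [z <= F (F z)] with equally many ones, so [F (F z) = z]. *)

Import Order.TTheory GRing.Theory Num.Theory.
Local Open Scope ring_scope.

Definition local_field {R : realType} {n : nat} (B : 'M[R]_n)
    (x : {ffun 'I_n -> bool}) (i : 'I_n) : R :=
  \sum_(j < n) B i j * (x j)%:R.

Definition threshold_map {R : realType} {n : nat} (B : 'M[R]_n)
    (theta : 'I_n -> R) (x : {ffun 'I_n -> bool}) : {ffun 'I_n -> bool} :=
  [ffun i => theta i <= local_field B x i].

Definition energy {R : realType} {n : nat} (B : 'M[R]_n) (theta : 'I_n -> R)
    (x y : {ffun 'I_n -> bool}) : R :=
  \sum_(i < n) (theta i * ((x i)%:R + (y i)%:R) - (y i)%:R * local_field B x i).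

Lemma local_field_sym {R : realType} {n : nat} (B : 'M[R]_n)
    (x y : {ffun 'I_n -> bool}) :
  B^T = B ->
  \sum_(i < n) (y i)%:R * local_field B x i =
  \sum_(i < n) (x i)%:R * local_field B y i.
Proof.
move=> B_sym; under eq_bigr do rewrite mulr_sumr.
rewrite exchange_big; apply: eq_bigr => j _ /=; rewrite mulr_sumr.
by apply: eq_bigr => i _; rewrite -[in LHS]B_sym mxE; ring.
Qed.

(** By symmetry the field of [x] paired with [y] equals the field of [y] paired with [x], so both
    energies are expressed through the field of the middle state [y], and the [theta]-terms in [y]
    cancel. *)
Lemma energyB {R : realType} {n : nat} (B : 'M[R]_n) (theta : 'I_n -> R)
    (x y z : {ffun 'I_n -> bool}) :
  B^T = B ->
  energy B theta x y - energy B theta y z =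
  \sum_(i < n) ((z i)%:R - (x i)%:R) * (local_field B y i - theta i).
Proof.
move=> B_sym; rewrite /energy big_split /= sumrN local_field_sym //.
rewrite -sumrN -big_split /= -sumrB.
by apply: eq_bigr => i _; ring.
Qed.

(** The updated bit is 1 exactly when [h - t] is nonnegative, so the two factors never have opposite
    signs. *)
Lemma threshold_gap_ge0 {R : realDomainType} (b : bool) (t h : R) :
  0 <= ((t <= h)%R%:R - b%:R) * (h - t).
Proof. by case: b; case: (lerP t h) => H /=; nra. Qed.

(** Only an implication survives: at a tie [h = t] the product vanishes, yet a bit 0 becomes 1. *)
Lemma threshold_gap_eq0 {R : realDomainType} (b : bool) (t h : R) :
  ((t <= h)%R%:R - b%:R) * (h - t) = 0 -> b ==> (t <= h).
Proof. by case: b; case: (lerP t h) => H //=; nra. Qed.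

Section ThresholdMap.

Context {R : realType} {n : nat} (B : 'M[R]_n) (theta : 'I_n -> R).
Hypothesis B_sym : B^T = B.

Let F := threshold_map B theta.
Let E (x : {ffun 'I_n -> bool}) := energy B theta x (F x).
Let ones (x : {ffun 'I_n -> bool}) := (\sum_(i < n) x i)%N.

Lemma energy_threshold_le x : E (F x) <= E x.
Proof.
rewrite -subr_ge0 /E energyB //; apply: sumr_ge0 => i _.
by rewrite ffunE; apply: threshold_gap_ge0.
Qed.

Lemma energy_threshold_eq x i : E (F x) = E x -> x i ==> F (F x) i.
Proof.
move=> /esym/eqP; rewrite -subr_eq0 /E energyB // psumr_eq0 => [/allP/(_ i)|j _].
  by rewrite mem_index_enum ffunE => /(_ isT)/eqP/threshold_gap_eq0.
by rewrite ffunE; apply: threshold_gap_ge0.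
Qed.

Lemma threshold_map_period2 x : exists s, iter (s + 2) F x = iter s F x.
Proof.
case: (arg_minP E (connect0 (frel F) x)) => y xy minE.
case: (arg_maxnP (fun z => ones z + ones (F z))%N (connect0 (frel F) y)).
move=> z yz maxN.
have constE w : fconnect F y w -> E w = E y.
  move=> yw; apply/eqP; rewrite eq_le minE ?(connect_trans xy yw) // andbT.
  rewrite -(iter_findex yw); elim: (findex _ _ _) => //= k.
  by apply: le_trans; apply: energy_threshold_le.
have yFz : fconnect F y (F z) := connect_trans yz (fconnect1 F z).
have zFF i : (z i <= F (F z) i)%N.
  have : z i ==> F (F z) i by apply: energy_threshold_eq; rewrite !constE.
  by case: (z i) => //= ->.
(* Passing from [z] to [F z] in the maximized sum replaces [ones z] by [ones (F (F z))]; the term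
   [ones (F z)] is common and cancels. *)
have ones_le : (ones (F (F z)) <= ones z)%N.
  by have /= := maxN _ yFz; rewrite addnC leq_add2r.
have FFz : F (F z) = z.
  have [_] := leqif_sum (fun i (_ : true) => leqif_eq (zFF i)).
  rewrite eqn_leq ones_le leq_sum // => /esym/forallP eqz; apply/ffunP => i.
  by have /eqP := eqz i; case: (z i); case: (F (F z) i).
exists (findex F x z); rewrite addnC iterD iter_findex //.
exact: connect_trans xy yz.
Qed.

End ThresholdMap.

Lemma bithreshold_threshold_map {R : realType} {n : nat} (A : 'M[R]_n)
    (kup kdown : 'I_n -> R) :
  synchronous_map (bithreshold A kup kdown) =1
  threshold_map (A + diag_mx (\row_i (kup i - kdown i))) kup.
Proof.
move=> x; apply/ffunP => i; rewrite !ffunE /bithreshold /local_field.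
under [in RHS]eq_bigr do rewrite !mxE mulrDl.
rewrite big_split /= [X in _ + X](bigD1 i) //= [X in _ + (_ + X)]big1 ?addr0; last first.
  by move=> j ji; rewrite eq_sym (negPf ji) mulr0n mul0r.
set sigma := \sum_(j < n) _; rewrite eqxx mulr1n.
case: (x i) => /=; last by rewrite mulr0 addr0; case: ifP.
(* At [x i = 1] the diagonal adds [kup i - kdown i] to [sigma], so the test against [kup i] becomes
   [kdown i <= sigma]. *)
by rewrite mulr1 addrCA lerDl subr_ge0 leNgt; case: ifP.
Qed.

Theorem theorem3p1 (R : realType) (n : nat) (n_ge1 : (1 <= n)%N)
    (A : 'M[R]_n) (A_sym : A^T = A) (kup kdown : 'I_n -> R)
    (x : {ffun 'I_n -> bool}) :
  exists s : nat,
    iter (s + 2) (synchronous_map (bithreshold A kup kdown)) x =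
    iter s (synchronous_map (bithreshold A kup kdown)) x.
Proof.
set B := A + diag_mx (\row_i (kup i - kdown i)).
have B_sym : B^T = B by rewrite linearD /= A_sym tr_diag_mx.
have [s Fs] := threshold_map_period2 B kup B_sym x.
exists s; rewrite !(eq_iter (bithreshold_threshold_map A kup kdown)).
exact: Fs.
Qed.
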